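(* There is no Turing machine which can take as input: (1) a finite symmetric set $X$ of bounded automaton automorphisms of the tree $\mathcal T_d=C^*$, where $C=\{c_1,\dots,c_d\}$, $d\ge2$; (2) a word $w\in X^*$ over the generating set $X$; and (3) a Turing machine $T$ which outputs an infinite ray $\eta\in C^\omega$; and then decide whether $w\in\mathrm{WP}(\langle X\rangle,X,\mathrm{Stab}(\eta))$.
   Context: The vertices of the $d$-regular rooted tree $\mathcal T_d$ are the words in $C^*$; the root is the empty word and the children of $v$ are $vc_1,\dots,vc_d$. $\mathrm{Aut}(\mathcal T_d)$ is the group of rooted-tree automorphisms, acting on the right; the action extends to infinite rays (infinite words) in $C^\omega$. For $\alpha\in\mathrm{Aut}(\mathcal T_d)$ and $v\in C^*$, the section $\alpha@v$ is the unique automorphism with $(vu)\cdot\alpha=(v\cdot\alpha)(u\cdot(\alpha@v))$ for all $u\in C^*$. An automorphism $\alpha$ is an automaton automorphism if $\{\alpha@v:v\in C^*\}$ is finite; such an automorphism is determined by finite data (a finite automaton whose states are its sections) and is given as input in this form. It is a bounded automaton automorphism if moreover there is a constant $N_\alpha$ with $\#\{v\in C^*:\alpha@v\ne1,\ |v|=k\}<N_\alpha$ for every positive integer $k$. For $G=\langle X\rangle$ and $\eta\in C^\omega$, $\mathrm{Stab}(\eta)=\{g\in G:\eta\cdot g=\eta\}$. For $w\in X^*$, $\overline w\in G$ is the product of its letters, and $\mathrm{WP}(G,X,H)=\{w\in X^*:\overline w\in H\}$ for a subgroup $H\le G$. A Turing machine outputs a ray if it successively writes all the letters of the infinite word. 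*)

(* Defs.v *)
From Stdlib Require List.
From mathcomp Require Import all_boot.
From mathcomp Require Import boolp classical_sets functions cardinality.

Set Implicit Arguments.
Unset Strict Implicit.
Unset Printing Implicit Defensive.

Local Open Scope classical_set_scope.

(** * Turing machines

  Machines are given in Turing's way, by a finite table of quintuples
  (state, scanned symbol; new state, new symbol, move).  There is one work
  tape, infinite in both directions, and a write-only, one-way output tape: an
  instruction may also write one letter there.  States, symbols and output
  letters are numbers, finitely many of which occur in a given table; the blank
  is 0 and the initial state is 0. *)

Inductive move := MoveLeft | Stay | MoveRight.

Record instruction := Instruction {
  i_state : nat;
  i_scanned : nat;
  i_next : nat;
  i_write : nat;
  i_move : move;
  i_emit : option nat }.

(* If several instructions apply, the first one is executed: a list stands for
   a partial transition function. *)
Definition machine := seq instruction.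

(* [c_left] lists the cells to the left of the head, nearest first; [c_right]
   lists the scanned cell and those to its right.  Cells beyond either list are
   blank.  [c_out] is what has been written on the output tape so far. *)
Record config := Config {
  c_state : nat;
  c_left : seq nat;
  c_right : seq nat;
  c_out : seq nat }.

Definition scanned (c : config) : nat := head 0 (c_right c).

Definition applicable (c : config) (i : instruction) : bool :=
  (i_state i == c_state c) && (i_scanned i == scanned c).

Definition execute (i : instruction) (c : config) : config :=
  let l := c_left c in
  let r := i_write i :: behead (c_right c) in
  let: (l', r') :=
    match i_move i with
    | MoveLeft => (behead l, head 0 l :: r)
    | Stay => (l, r)
    | MoveRight => (i_write i :: l, behead r)
    end in
  Config (i_next i) l' r'
    (if i_emit i is Some a then rcons (c_out c) a else c_out c).

(* [None]: no instruction applies, the machine has halted. *)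
Definition step (M : machine) (c : config) : option config :=
  omap (fun i => execute i c) (ohead (filter (applicable c) M)).

Definition initial (input : seq nat) : config := Config 0 [::] input [::].

Definition run (M : machine) (input : seq nat) (t : nat) : config :=
  iter t (fun c => odflt c (step M c)) (initial input).

Definition halts_with (M : machine) (input output : seq nat) : Prop :=
  exists t, step M (run M input t) = None /\ c_out (run M input t) = output.

(** * The tree [C^*] for [C = 'I_d], and its automorphisms *)

Section Tree.
Variable d : nat.

Definition word := seq 'I_d.
Definition ray := nat -> 'I_d.

Definition child (u v : word) : Prop := exists c : 'I_d, v = rcons u c.

(* Group elements act on the right: [g v] is the vertex v . g. *)
Definition tree_automorphism (g : word -> word) : Prop :=
  [/\ bijective g, g [::] = [::] &
      forall u v, child u v <-> child (g u) (g v)].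

Definition section (g : word -> word) (v u : word) : word :=
  drop (size v) (g (v ++ u)).

Definition automaton_automorphism (g : word -> word) : Prop :=
  tree_automorphism g /\ finite_set (range (section g)).

Definition bounded_automaton_automorphism (g : word -> word) : Prop :=
  automaton_automorphism g /\
  exists N : nat, forall k : nat, 0 < k ->
    #|[set v : k.-tuple 'I_d | `[< section g v <> id >]]%SET| < N.

(* For a tree automorphism g the prefixes of eta . g are the images under g of
   the prefixes of eta; the default value [eta 0] is then irrelevant. *)
Definition ray_act (g : word -> word) (eta : ray) : ray :=
  fun n => nth (eta 0) (g (mkseq eta n.+1)) n.

(** ** Groups of automorphisms *)

(* With right actions, the leftmost letter acts first. *)
Definition word_prod (w : seq (word -> word)) : word -> word :=
  foldr (fun g h => h \o g) id w.

Inductive generated (X : set (word -> word)) : set (word -> word) :=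
| generated_one : generated X id
| generated_gen g : X g -> generated X g
| generated_mul g h : generated X g -> generated X h -> generated X (h \o g)
| generated_inv g h :
    generated X g -> cancel g h -> cancel h g -> generated X h.

Definition symmetric_set (X : set (word -> word)) : Prop :=
  forall g, X g -> exists2 h, X h & cancel g h /\ cancel h g.

Definition Stab (G : set (word -> word)) (eta : ray) : set (word -> word) :=
  [set g | G g /\ ray_act g eta = eta].

Definition WP (X H : set (word -> word)) : set (seq (word -> word)) :=
  [set w | List.Forall X w /\ H (word_prod w)].

(** ** Finite automata *)

Record automaton := Automaton {
  nstates : nat;
  start : 'I_nstates;
  letter : 'I_nstates -> 'I_d -> 'I_d;
  next : 'I_nstates -> 'I_d -> 'I_nstates }.

Fixpoint state_act (A : automaton) (q : 'I_(nstates A)) (v : word) : word :=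
  if v is c :: v' then letter q c :: state_act (next q c) v' else [::].

Definition automaton_act (A : automaton) : word -> word :=
  state_act (start A).

(* The states of A are, without repetition, the sections of the automorphism
   defined by A. *)
Definition states_are_sections (A : automaton) : Prop :=
  injective (@state_act A) /\
  range (@state_act A) = range (section (automaton_act A)).

(* T, started on the blank tape, successively writes the letters of eta. *)
Definition outputs_ray (T : machine) (eta : ray) : Prop :=
  forall n, exists t,
    prefix (mkseq (fun i => nat_of_ord (eta i)) n) (c_out (run T [::] t)).

(** * Encoding of the input

  Every datum is flattened to a list of numbers, and each number n is written
  on the tape in unary, as n symbols 2 followed by a symbol 1. *)

Definition tape_code (s : seq nat) : seq nat :=
  flatten [seq rcons (nseq n 2) 1 | n <- s].

Definition code_automaton (A : automaton) : seq nat :=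
  [:: nstates A, nat_of_ord (start A) &
     flatten [seq [:: nat_of_ord (letter q c); nat_of_ord (next q c)]
             | q <- enum 'I_(nstates A), c <- enum 'I_d]].

Definition code_move (m : move) : nat :=
  match m with MoveLeft => 0 | Stay => 1 | MoveRight => 2 end.

Definition code_instruction (i : instruction) : seq nat :=
  [:: i_state i; i_scanned i; i_next i; i_write i; code_move (i_move i);
      if i_emit i is Some a then a.+1 else 0].

Definition code_machine (M : machine) : seq nat :=
  flatten (map code_instruction M).

(* The machine comes last, so its length need not be recorded. *)
Definition code_input (k : nat) (A : k.-tuple automaton) (w : seq 'I_k)
    (T : machine) : seq nat :=
  tape_code (k :: flatten (map code_automaton A)
             ++ size w :: map (@nat_of_ord k) w ++ code_machine T).

End Tree.

(* Main.v *)
Require Import Defs.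
From mathcomp Require Import all_boot.
From mathcomp Require Import boolp classical_sets functions cardinality.

Set Implicit Arguments.
Unset Strict Implicit.
Unset Printing Implicit Defensive.

Local Open Scope classical_set_scope.

(** Let b be the automorphism that fixes the ray 0^omega and, on a word starting
  with 0^n 1, exchanges 0 and 1 in the letter that follows.  It is a bounded
  involution, and it fixes a ray over {0, 1} only if that ray is 0^omega.  So a
  decision machine D for X = {b} and w = b would decide whether the ray written
  by T is 0^omega.  By the recursion theorem there is a machine T which writes
  the input made of b, w and its own code on the tape and then imitates D on
  it, writing 1 whenever D writes 1, and writing 0 at every other step, forever
  if D halts.  The ray of T is 0^omega if and only if D never writes a 1, which
  contradicts the answer of D on this input.

  T consists of three tables.  The printer writes a constant word y; the
  generator, independent of y, appends the code of the printer of y; the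
  observer imitates D.  The word y, followed by 1, is the code of b, w, the
  generator and the observer.  To let the generator know the states of the
  printer from y alone, the printer uses the even states 0, 2, 4, ... and the
  other tables odd ones. *)

(** * Machines *)

Definition lookup (M : machine) (q a : nat) : option instruction :=
  ohead (filter (fun i => (i_state i == q) && (i_scanned i == a)) M).

Lemma stepE M c :
  step M c = omap (fun i => execute i c) (lookup M (c_state c) (scanned c)).
Proof. by rewrite /step /lookup; congr (omap _ (ohead _)); apply: eq_filter. Qed.

Lemma lookup_cat M N q a :
  lookup (M ++ N) q a = if lookup M q a is Some i then Some i else lookup N q a.
Proof. by rewrite /lookup filter_cat; case: filter. Qed.

Lemma lookup_catl M N q a i :
  lookup M q a = Some i -> lookup (M ++ N) q a = Some i.
Proof. by rewrite lookup_cat => ->. Qed.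

Lemma lookup_none M q a :
  all (fun i => i_state i != q) M -> lookup M q a = None.
Proof.
by rewrite /lookup; elim: M => //= i M IH /andP[/negPf-> /IH].
Qed.

Lemma lookup_catr M N q a :
  all (fun i => i_state i != q) M -> lookup (M ++ N) q a = lookup N q a.
Proof. by rewrite lookup_cat => /lookup_none->. Qed.

Lemma lookup_all M q a i (p : pred instruction) :
  all p M -> lookup M q a = Some i -> p i.
Proof.
rewrite /lookup; elim: M => //= j M IH /andP[pj /IH{}IH].
by case: ifP => // _ [<-].
Qed.

Definition go q a q' b m := Instruction q a q' b m (Some 0).

(* From state and tape [c], [M] reaches [c'] writing a 0 at every step. *)
Definition leads (M : machine) (c c' : nat * seq nat * seq nat) : Prop :=
  exists n, forall o,
    iter n (obind (step M)) (Some (Config c.1.1 c.1.2 c.2 o)) =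
      Some (Config c'.1.1 c'.1.2 c'.2 (o ++ nseq n 0)).

Section Leads.
Variable M : machine.

Lemma leads_refl c : leads M c c.
Proof. by exists 0 => o; rewrite /= cats0. Qed.

Lemma leads_trans c' c c'' : leads M c c' -> leads M c' c'' -> leads M c c''.
Proof.
move=> [m Hm] [n Hn]; exists (n + m) => o.
by rewrite iterD Hm Hn -catA -nseqD addnC.
Qed.

Lemma leads1 q l r a q' b m :
  a = head 0 r -> lookup M q a = Some (go q a q' b m) ->
  let c := execute (go q a q' b m) (Config q l r [::]) in
  leads M (q, l, r) (c_state c, c_left c, c_right c).
Proof.
move=> -> H; exists 1 => o /=; rewrite stepE /= H /= /execute /=.
by case: m {H} => /=; rewrite cats1.
Qed.

Lemma goR q a q' b l r :
  lookup M q a = Some (go q a q' b MoveRight) ->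
  leads M (q, l, a :: r) (q', b :: l, r).
Proof. by move=> /(@leads1 q l (a :: r) _ _ _ _ erefl). Qed.

Lemma goR0 q q' b l :
  lookup M q 0 = Some (go q 0 q' b MoveRight) ->
  leads M (q, l, [::]) (q', b :: l, [::]).
Proof. by move=> /(@leads1 q l [::] _ _ _ _ erefl). Qed.

Lemma goL q a q' b l r :
  lookup M q a = Some (go q a q' b MoveLeft) ->
  leads M (q, l, a :: r) (q', behead l, head 0 l :: b :: r).
Proof. by move=> /(@leads1 q l (a :: r) _ _ _ _ erefl). Qed.

Lemma goS0 q q' b l :
  lookup M q 0 = Some (go q 0 q' b Stay) ->
  leads M (q, l, [::]) (q', l, [:: b]).
Proof. by move=> /(@leads1 q l [::] _ _ _ _ erefl). Qed.

Lemma sweepR q s l r :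
  {in s, forall a, lookup M q a = Some (go q a q a MoveRight)} ->
  leads M (q, l, s ++ r) (q, rev s ++ l, r).
Proof.
elim: s l => [|a s IH] l H; first exact: leads_refl.
apply: leads_trans (goR _ _ (H a (mem_head _ _))) _.
rewrite rev_cons cat_rcons; apply: IH => b Hb; apply: H.
by rewrite inE Hb orbT.
Qed.

Lemma sweepL q s f a l r :
  {in a :: s, forall a, lookup M q a = Some (go q a q (f a) MoveLeft)} ->
  leads M (q, s ++ l, a :: r) (q, behead l, head 0 l :: rev (map f (a :: s)) ++ r).
Proof.
elim: s a l r => [|b s IH] a l r H.
  by apply: goL; apply: H; rewrite mem_head.
apply: leads_trans (goL _ _ (H a (mem_head _ _))) _ => /=.
rewrite rev_cons cat_rcons; apply: IH => c Hc; apply: H.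
by rewrite inE Hc orbT.
Qed.

End Leads.

(** * Self-reproduction *)

Definition keep (q : nat) (m : move) (s : seq nat) : machine :=
  [seq go q a q a m | a <- s].

(** The first letter is written where the sweep in state [q] meets a blank. The last one is written
    without moving, since a leftward sweep started on a blank would mistake it for the left end. *)
Fixpoint chain (q base : nat) (u : seq nat) (q' : nat) : machine :=
  match u with
  | [::] => [::]
  | [:: a] => [:: go q 0 q' a Stay]
  | a :: u' => go q 0 base a MoveRight :: chain base base.+2 u' q'
  end.

(* The code of the printer's instruction that writes [c] in state [2 * n] is
   [2^(2n) 1 1 2^(2n)] followed by [row_word c]. *)
Definition row_word (c : nat) : seq nat :=
  [:: 2; 2; 1] ++ rcons (nseq c 2) 1 ++ [:: 2; 2; 1; 2; 1].

(* Likewise for its last instruction, after [2^(2n)]. *)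
Definition last_row_word : seq nat :=
  [:: 1; 1; 2; 1; 2; 2; 2; 2; 2; 1; 2; 1; 2; 1].

(* On the tape of the generator, the letter a of y is written a while it is
   unprocessed, and 2 + a or 6 + a when it is processed; a separating 5 follows
   y, and then come the letters a of the code produced so far, written 4 + a.
   The copier turns, from right to left, each [alpha + a] into [beta + a] and
   appends two symbols 6 for each, as the printer's states increase by two. *)
Definition copier (c1 c2 c3 alpha beta q' : nat) : machine :=
  let s := [:: 1; 2; 5; 6; beta + 1; beta + 2] in
  keep c1 MoveLeft s ++
  [:: go c1 (alpha + 1) c2 (beta + 1) MoveRight;
      go c1 (alpha + 2) c2 (beta + 2) MoveRight;
      go c1 0 q' 0 MoveRight] ++
  keep c2 MoveRight s ++
  [:: go c2 0 c3 6 MoveRight; go c3 0 c1 6 Stay].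

(* States 3 to 19, 23 to 27 and 31 to 69 treat one letter of y.  The two passes
   of the copier, with the roles of 2 and 6 exchanged, write the new state of
   its instruction and the state of the next instruction.  States 29 and 71 to
   95 append the last instruction, and state 21 restores the letters 1 and 2. *)
Definition generator : machine :=
  keep 1 MoveLeft [:: 1; 2; 5] ++ [:: go 1 0 3 0 MoveRight] ++
  keep 3 MoveRight [:: 3; 4] ++
  [:: go 3 1 5 1 MoveRight; go 3 2 5 2 MoveRight; go 3 5 29 5 MoveRight] ++
  keep 5 MoveRight [:: 1; 2; 5; 6] ++ chain 5 7 [:: 5; 5] 9 ++
  copier 9 11 13 2 6 15 ++
  keep 15 MoveRight [:: 7; 8] ++
  [:: go 15 1 17 7 MoveRight; go 15 2 19 8 MoveRight] ++
  keep 17 MoveRight [:: 1; 2; 5; 6] ++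
  chain 17 31 (map (addn 4) (row_word 1)) 23 ++
  keep 19 MoveRight [:: 1; 2; 5; 6] ++
  chain 19 51 (map (addn 4) (row_word 2)) 23 ++
  copier 23 25 27 6 2 3 ++
  keep 29 MoveRight [:: 5; 6] ++
  chain 29 71 (map (addn 4) last_row_word) 21 ++
  [:: go 21 3 21 1 MoveLeft; go 21 4 21 2 MoveLeft;
      go 21 5 21 1 MoveLeft; go 21 6 21 2 MoveLeft;
      go 21 0 101 0 MoveRight].

(* The final 5 stands for the 1 that follows y, and marks the end of y. *)
Fixpoint printer (q : nat) (y : seq nat) : machine :=
  if y is c :: y' then go q 0 q.+2 c MoveRight :: printer q.+2 y'
  else [:: go q 0 1 5 Stay].

(** * Correctness of the printer and the generator *)

Definition binary (s : seq nat) : bool := all (mem [:: 1; 2]) s.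

Lemma forall_in_cons (T : eqType) (P : T -> Prop) x s :
  P x -> {in s, forall a, P a} -> {in x :: s, forall a, P a}.
Proof. by move=> Px Ps a; rewrite inE => /predU1P[->|/Ps]. Qed.

Lemma forall_in_nil (T : eqType) (P : T -> Prop) : {in [::], forall a, P a}.
Proof. by []. Qed.

Lemma binaryP s : reflect {in s, forall a, a = 1 \/ a = 2} (binary s).
Proof.
apply: (iffP allP) => H a /H => [|[]->] //.
by rewrite /= !inE => /orP[] /eqP; [left|right].
Qed.

Lemma binary_rcons s x : binary (rcons s x) = (x \in [:: 1; 2]) && binary s.
Proof. exact: all_rcons. Qed.

(** The premises on [l] admit both [[::]], as the printer leaves it, and [[:: 0]], as an earlier
    turn at the left end leaves it. *)
Lemma rewind M q q' f W e l :
  {in rcons W e, forall a, lookup M q a = Some (go q a q (f a) MoveLeft)} ->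
  lookup M q 0 = Some (go q 0 q' 0 MoveRight) ->
  behead l = [::] -> head 0 l = 0 ->
  leads M (q, rev W ++ l, [:: e]) (q', [:: 0], map f (rcons W e)).
Proof.
move=> H H0 l1 l2; apply: leads_trans.
  apply: (@sweepL _ _ _ f) => a Ha; apply: H.
  by move: Ha; rewrite inE mem_rev mem_rcons inE.
rewrite l1 l2 cats0; apply: leads_trans (goR _ _ H0) _.
by rewrite -map_rev rev_cons revK; apply: leads_refl.
Qed.

(** Induction on [s] from its right end, since the rightmost unprocessed letter is copied first; it
    then joins the block [rcons R e] together with two new 6s. *)
Lemma copier_leads M c1 c2 c3 alpha beta q' s R e :
  let S := [:: 1; 2; 5; 6; beta + 1; beta + 2] in
  {in S, forall a, lookup M c1 a = Some (go c1 a c1 a MoveLeft)} ->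
  {in S, forall a, lookup M c2 a = Some (go c2 a c2 a MoveRight)} ->
  {in [:: 1; 2], forall x, lookup M c1 (alpha + x) =
                             Some (go c1 (alpha + x) c2 (beta + x) MoveRight)} ->
  lookup M c1 0 = Some (go c1 0 q' 0 MoveRight) ->
  lookup M c2 0 = Some (go c2 0 c3 6 MoveRight) ->
  lookup M c3 0 = Some (go c3 0 c1 6 Stay) ->
  binary s -> all (mem S) (rcons R e) ->
  leads M (c1, rev (map (addn alpha) s ++ R) ++ [:: 0], [:: e])
    (q', [:: 0], map (addn beta) s ++ rcons R e ++ nseq (size s).*2 6).
Proof.
move=> S H1 H2 Hx H10 H20 H3.
elim/last_ind: s R e => [|s x IH] R e.
  move=> _ /allP HR; rewrite /= cats0.
  have := @rewind M c1 q' id R e [:: 0]; rewrite map_id; apply=> // a /HR.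
  exact: H1.
rewrite binary_rcons => /andP[x12 sb] HR.
rewrite map_rcons cat_rcons rev_cat rev_cons cat_rcons -!catA /=.
have R1 : {in e :: rev R, forall a,
    lookup M c1 a = Some (go c1 a c1 (id a) MoveLeft)}.
  move=> a; rewrite inE mem_rev -in_cons -mem_rcons => /(allP HR); exact: H1.
apply: leads_trans (sweepL _ _ R1) _ => /=.
rewrite cats0 map_id rev_cons revK.
apply: leads_trans (goR _ _ (Hx _ x12)) _.
rewrite -[rcons R e]cats0.
apply: leads_trans; first by apply: sweepR => a /(allP HR); apply: H2.
apply: leads_trans (goR0 _ H20) _.
apply: leads_trans (goS0 _ H3) _.
have := IH ((beta + x) :: rcons (rcons R e) 6) 6 sb.
rewrite rev_cat rev_cons rev_rcons cat_cons cat_rcons -cats1 -catA /= => H.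
have E : nseq (size (rcons s x)).*2 6 = 6 :: 6 :: nseq (size s).*2 6.
  by rewrite size_rcons doubleS.
rewrite E map_rcons cat_rcons.
move: H; rewrite !rev_rcons !cat_rcons -!catA; apply.
move: HR; rewrite all_rcons all_cat => /andP[He ->].
rewrite /= (idP He : e \in S) !inE /= !andbT.
by move: x12; rewrite !inE => /orP[] /eqP->; rewrite eqxx ?orbT.
Qed.

Lemma code_printer q y :
  tape_code (code_machine (printer q y)) =
    if y is c :: y' then
      nseq q 2 ++ [:: 1; 1] ++ nseq q 2 ++ row_word c ++
        tape_code (code_machine (printer q.+2 y'))
    else nseq q 2 ++ last_row_word.
Proof.
case: y => [|c y']; rewrite /tape_code /code_machine /=.
  by rewrite -!cats1 -!catA.
rewrite /row_word -!cats1 -!catA /=.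
have E w : 2 :: nseq q 2 ++ w = nseq q 2 ++ 2 :: w by elim: q => //= q ->.
by rewrite !E.
Qed.

Section Generator.
Variable N : machine.
Let M := generator ++ N.

Local Ltac table := by apply: lookup_catl; vm_compute.
Local Ltac tables :=
  repeat (apply: forall_in_cons; first by table); apply: forall_in_nil.

(** Loop invariant: the state [m] of the next instruction already stands, in unary, at the end of
    the tape. One round completes this instruction and writes the state [m.+2] of the following
    one. *)
Lemma generator_row s c s' W :
  let m := (size s).*2 in
  binary s -> binary (c :: s') -> binary W ->
  leads M
    (3, [:: 0], map (addn 2) s ++ c :: s' ++ 5 :: map (addn 4) W ++ nseq m 6)
    (3, [:: 0], map (addn 2) (rcons s c) ++ s' ++
       5 :: map (addn 4) (W ++ nseq m 2 ++ [:: 1; 1] ++ nseq m 2 ++ row_word c) ++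
       nseq m.+2 6).
Proof.
move=> m bs /andP[c12 bs'] /binaryP bW.
have {}bs' := elimT (binaryP _) bs'.
have c12' : c = 1 \/ c = 2.
  by move: c12; rewrite /= !inE => /orP[] /eqP; [left|right].
set Z := s' ++ _.
have HZ : {in Z, forall a, a \in [:: 1; 2; 5; 6]}.
  move=> a; rewrite mem_cat inE mem_cat mem_nseq => /or4P[/bs'[]->|/eqP->||] //.
    by case/mapP=> x /bW[->|->] ->.
  by case/andP=> _ /eqP->.
apply: leads_trans.
  by apply: sweepR => a /mapP[x /(elimT (binaryP _) bs)[->|->] ->]; table.
apply: leads_trans (_ : leads M _ (5, c :: _, Z)) _.
  by apply: goR; case: c12' => ->; table.
rewrite -{1}[Z]cats0; apply: leads_trans.
  by apply: sweepR; apply: (sub_in1 HZ); tables.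
apply: leads_trans; first by apply: goR0; table.
apply: leads_trans; first by apply: goS0; table.
(* The first pass appends [m] symbols 6 for the new state [m.+2]; its other two come from
   [row_word c]. *)
have := @copier_leads M 9 11 13 2 6 15 s (c :: rcons Z 5) 5.
rewrite rev_cat rev_cons rev_rcons cat_rcons -catA => H.
apply: leads_trans; first apply: H => //; try table.
- by tables.
- by tables.
- by tables.
- rewrite rcons_cons /= all_rcons all_rcons /= !inE.
  apply/andP; split; first by case: c12' => ->.
  by apply/allP => a /HZ /=; rewrite !inE => /or4P[] /eqP->.
apply: leads_trans.
  by apply: sweepR => a /mapP[x /(elimT (binaryP _) bs)[->|->] ->]; table.
set Z2 := rcons (rcons Z 5) 5 ++ nseq m 6.
have HZ2 : {in Z2, forall a, a \in [:: 1; 2; 5; 6]}.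
  move=> a; rewrite mem_cat mem_nseq !(mem_rcons, in_cons).
  by case/orP=> [/or3P[/eqP->|/eqP->|/HZ]|/andP[_ /eqP->]].
(* [row_word c] has 9 + c letters; the last one, a 1 written as 5, stays under the head. *)
pose V := map (addn 4) (take (8 + c) (row_word c)).
apply: (@leads_trans _ (23, rev (Z2 ++ V) ++
    (6 + c) :: rev (map (addn 6) s) ++ [:: 0], [:: 5])).
  apply: (@leads_trans _ (15 + c.*2, (6 + c) :: rev (map (addn 6) s) ++ [:: 0], Z2)).
    by apply: goR; case: c12' => ->; table.
  rewrite -{1}[Z2]cats0; apply: leads_trans.
    by apply: sweepR; apply: (sub_in1 HZ2); case: c12' => ->; tables.
  rewrite /V rev_cat.
  case: c12' => ->; do 9 ?(apply: leads_trans; first by apply: goR0; table).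
    by apply: goS0; table.
  apply: leads_trans; first by apply: goR0; table.
  by apply: goS0; table.
have := @copier_leads M 23 25 27 6 2 3 (rcons s c) (Z2 ++ V) 5.
rewrite map_rcons cat_rcons rev_cat rev_cons cat_rcons -catA => {}H.
have -> : s' ++
      5 :: map (addn 4) (W ++ nseq m 2 ++ [:: 1; 1] ++ nseq m 2 ++ row_word c) ++
      nseq m.+2 6 = rcons (Z2 ++ V) 5 ++ nseq (size (rcons s c)).*2 6.
  rewrite size_rcons doubleS -/m /Z2 /Z !map_cat !map_nseq -!cats1 -!catA /=.
  by rewrite -!catA; case: c12' => ->.
apply: H => //; try table.
- by tables.
- by tables.
- by tables.
- by rewrite binary_rcons bs andbT; exact: c12.
rewrite all_rcons all_cat; apply/and3P; split=> //.
  by apply/allP => a /HZ2; rewrite !inE => /or4P[] /eqP->.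
by rewrite /V; case: c12' => ->.
Qed.

Lemma generator_end s W :
  binary s -> binary W ->
  leads M (3, [:: 0], map (addn 2) s ++ 5 :: map (addn 4) W ++ nseq (size s).*2 6)
   (101, [:: 0], s ++ 1 :: W ++ nseq (size s).*2 2 ++ last_row_word).
Proof.
move=> /binaryP bs /binaryP bW.
apply: leads_trans.
  apply: sweepR => a /mapP[x /bs[->|->] ->]; table.
apply: leads_trans; first by apply: goR; table.
rewrite -[map _ _ ++ nseq _ _]cats0.
apply: leads_trans.
  apply: sweepR => a; rewrite mem_cat mem_nseq.
  case/orP=> [/mapP[x /bW[->|->] ->]|]; try table.
  by case/andP=> _ /eqP->; table.
do 13 (apply: leads_trans; first by apply: goR0; table).
apply: leads_trans; first by apply: goS0; table.
(* [f] undoes both encodings 2 + a and 4 + a, and turns the separator 5 into the 1 that follows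
   [s]. *)
pose f x := if x <= 4 then x - 2 else x - 4.
pose V := map (addn 2) s ++ 5 :: (map (addn 4) W ++ nseq (size s).*2 6) ++
  map (addn 4) (take 13 last_row_word).
have fm b t : {in [:: 1; 2], forall x, f (b + x) = x} ->
  {in t, forall a, a = 1 \/ a = 2} -> map f (map (addn b) t) = t.
  move=> fb bt; rewrite -map_comp map_id_in // => x /bt[->|->]; exact: fb.
have := @rewind M 21 101 f V 5 [:: 0].
rewrite rev_cat rev_cons cat_rcons rev_cat -!catA /= => H.
have -> : s ++ 1 :: W ++ nseq (size s).*2 2 ++ last_row_word = map f (rcons V 5).
  rewrite -cats1 !map_cat /= !map_cat map_nseq !fm //; last 2 first.
  - by move=> x; rewrite !inE => /orP[] /eqP->.
  - by move=> x; rewrite !inE => /orP[] /eqP->.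
  by rewrite /= -!catA cat_cons -!catA.
have HV : {in rcons V 5, forall a, a \in [:: 3; 4; 5; 6]}.
  apply/allP; rewrite all_rcons all_cat /= !all_cat all_nseq orbT !andbT.
  apply/andP; split; apply/allP => _ /mapP[x Hx ->].
    by case: (bs _ Hx) => ->.
  by case: (bW _ Hx) => ->.
apply: H => //; try table.
by apply: (sub_in1 HV); tables.
Qed.

End Generator.

Lemma binary_tape_code s : binary (tape_code s).
Proof.
rewrite /tape_code /binary; elim: s => //= n s IH.
by rewrite all_cat IH all_rcons all_nseq orbT.
Qed.

Lemma tape_code_cat s t : tape_code (s ++ t) = tape_code s ++ tape_code t.
Proof. by rewrite /tape_code map_cat flatten_cat. Qed.

Lemma tape_code_rcons s n : tape_code (rcons s n) = rcons (tape_code s ++ nseq n 2) 1.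
Proof. by rewrite -cats1 tape_code_cat rcons_cat /tape_code /= cats0. Qed.

Lemma code_machine_cat M N : code_machine (M ++ N) = code_machine M ++ code_machine N.
Proof. by rewrite /code_machine map_cat flatten_cat. Qed.

Lemma generator_leads N s s' W :
  binary s -> binary s' -> binary W ->
  leads (generator ++ N)
    (3, [:: 0], map (addn 2) s ++ s' ++
       5 :: map (addn 4) W ++ nseq (size s).*2 6)
    (101, [:: 0], s ++ s' ++
       1 :: W ++ tape_code (code_machine (printer (size s).*2 s'))).
Proof.
elim: s' s W => [|c s' IH] s W bs bs' bW; rewrite code_printer.
  exact: generator_end.
apply: leads_trans (generator_row _ bs bs' bW) _.
case/andP: bs' => c12 bs'.
rewrite -doubleS -(size_rcons s c).
set W' := W ++ _.
have -> : s ++ (c :: s') ++ 1 :: W ++ nseq (size s).*2 2 ++ [:: 1; 1] ++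
      nseq (size s).*2 2 ++ row_word c ++
      tape_code (code_machine (printer (size (rcons s c)).*2 s')) =
    rcons s c ++ s' ++ 1 :: W' ++
      tape_code (code_machine (printer (size (rcons s c)).*2 s')).
  by rewrite cat_rcons /W' -!catA.
apply: IH => //; first by rewrite binary_rcons bs andbT.
rewrite /binary !all_cat !all_nseq orbT /= all_rcons all_nseq orbT /= !andbT.
exact: bW.
Qed.

(** Agreement is asked only on even states from [q] on: this passes to the tail of the printer, and
    it holds in the full table, whose other parts have odd states. *)
Lemma printer_leads M q y l :
  ~~ odd q ->
  (forall j, ~~ odd j -> q <= j -> lookup M j 0 = lookup (printer q y) j 0) ->
  leads M (q, l, [::]) (1, rev y ++ l, [:: 5]).
Proof.
elim: y q l => [|c y IH] q l ev H.
  by apply: goS0; rewrite H // /lookup /= !eqxx.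
apply: leads_trans; first by apply: goR0; rewrite H // /lookup /= !eqxx.
rewrite rev_cons cat_rcons; apply: IH; first by rewrite /= negbK.
move=> j ej lej; rewrite H //; last by apply: leq_trans lej; rewrite leqW.
by rewrite /lookup /= ltn_eqF //; apply: leq_trans lej.
Qed.

(** The printer stands last in the table because its code is appended last. Here [y] is any binary
    word; it is specialised only in [self_applied]. *)
Lemma self_leads N y :
  all (fun i => odd (i_state i)) N -> binary y ->
  leads (generator ++ N ++ printer 0 y) (0, [::], [::])
    (101, [:: 0], rcons y 1 ++ tape_code (code_machine (printer 0 y))).
Proof.
move=> oddN biny; set M := generator ++ _.
have H1 : {in rcons y 5, forall a, lookup M 1 a = Some (go 1 a 1 (id a) MoveLeft)}.
  have sub : {in rcons y 5, forall a, a \in [:: 1; 2; 5]}.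
    move=> a; rewrite mem_rcons inE => /predU1P[->//|].
    by move/(elimT (binaryP _) biny)=> [->|->].
  apply: (sub_in1 sub); repeat (apply: forall_in_cons;
    first by apply: lookup_catl; vm_compute); exact: forall_in_nil.
apply: leads_trans.
  apply: (@printer_leads _ 0 y) => // j ej _; rewrite !lookup_catr //.
    by apply: sub_all oddN => i; apply: contraL => /eqP->.
  have : all (fun i => odd (i_state i)) generator by vm_compute.
  by apply: sub_all => i; apply: contraL => /eqP->.
have H0 : lookup M 1 0 = Some (go 1 0 3 0 MoveRight).
  by apply: lookup_catl; vm_compute.
apply: leads_trans (rewind (l := [::]) H1 H0 erefl erefl) _.
rewrite map_id -cats1 cat_rcons.
exact: (@generator_leads _ [::] y [::]).
Qed.

(** * Imitation of a machine *)

(** The image of the initial state 0 is 101, where the generator stops. All images are odd and at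
    least 101, hence distinct from the states of the printer and the generator. *)
Definition shift_state (q : nat) : nat := q.*2 + 101.

Definition shift_instruction (i : instruction) : instruction :=
  Instruction (shift_state (i_state i)) (i_scanned i) (shift_state (i_next i))
    (i_write i) (i_move i) (Some (nat_of_bool (i_emit i == Some 1))).

(* Where [D] halts, the observer repeats the same step forever. *)
Definition stall (q a : nat) : instruction :=
  go (shift_state q) a (shift_state q) a Stay.

(** The stalling table must be finite, so it covers only what can occur when [D] runs on an encoded
    input; [.+3] makes room for the symbols 0, 1 and 2. *)
Definition state_bound (D : machine) : nat := (\max_(i <- D) i_next i).+1.
Definition symbol_bound (D : machine) : nat := (\max_(i <- D) i_write i).+3.

Definition observer (D : machine) : machine :=
  map shift_instruction D ++
  [seq stall q a | q <- iota 0 (state_bound D), a <- iota 0 (symbol_bound D)].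

Lemma shift_state_eq q q' : (shift_state q == shift_state q') = (q == q').
Proof. by rewrite eqn_add2r -!muln2 eqn_pmul2r. Qed.

Lemma lookup_stall s t q a :
  q \in s -> a \in t ->
  lookup [seq stall q a | q <- s, a <- t] (shift_state q) a = Some (stall q a).
Proof.
move=> qs at_; elim: s qs => //= p s IH; rewrite inE lookup_cat.
have [->|npq /= /IH ->] := eqVneq q p; last first.
  rewrite lookup_none // all_map; apply/allP => b _ /=.
  by rewrite shift_state_eq eq_sym.
suff -> : lookup [seq stall p b | b <- t] (shift_state p) a = Some (stall p a) by [].
elim: t at_ {IH} => //= b t IH; rewrite inE /lookup /= eqxx /= eq_sym.
by case: eqP => [->|_ /IH].
Qed.

Lemma lookup_observer D q a :
  q < state_bound D -> a < symbol_bound D ->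
  lookup (observer D) (shift_state q) a =
    Some (if lookup D q a is Some i then shift_instruction i else stall q a).
Proof.
move=> qQ aS; rewrite lookup_cat lookup_stall ?mem_iota //.
have -> : lookup (map shift_instruction D) (shift_state q) a =
          omap shift_instruction (lookup D q a).
  by rewrite /lookup; elim: D {qQ aS} => //= i D IH; rewrite shift_state_eq; case: ifP.
by case: lookup.
Qed.

(** Lists for the same half-tape may differ by trailing blanks, as [[:: 0]] and [[::]] do on the
    left when the imitation starts. *)
Definition same_tape (s t : seq nat) : Prop := nth 0 s =1 nth 0 t.

Definition symbols_below (S : nat) (s : seq nat) : bool := all (ltn^~ S) s.

Lemma same_tape_behead s t : same_tape s t -> same_tape (behead s) (behead t).
Proof. by move=> E n; rewrite !nth_behead. Qed.

Lemma same_tape_head s t : same_tape s t -> head 0 s = head 0 t.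
Proof. by move=> E; rewrite -!nth0. Qed.

Lemma same_tape_cons a b s t : a = b -> same_tape s t -> same_tape (a :: s) (b :: t).
Proof. by move=> -> E [|n] //=; apply: E. Qed.

Lemma same_tape_head_behead s t :
  same_tape s t -> same_tape (head 0 s :: behead s) t.
Proof. by move=> E [|n] /=; rewrite ?nth_behead // -nth0. Qed.

Lemma symbols_below_behead S s : symbols_below S s -> symbols_below S (behead s).
Proof. by case: s => //= a s /andP[]. Qed.

Lemma symbols_below_head S s : 0 < S -> symbols_below S s -> head 0 s < S.
Proof. by case: s => //= a s _ /andP[]. Qed.

(** Only the presence of a 1 is compared, because the observer writes 0 whenever [D] does not write
    1. The bounds ensure that the observer has an instruction to execute. *)
Definition observes (D : machine) (c c' : config) : Prop :=
  [/\ [/\ c_state c' = shift_state (c_state c) & c_state c < state_bound D],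
      same_tape (c_left c') (c_left c) /\ same_tape (c_right c') (c_right c),
      symbols_below (symbol_bound D) (c_left c) /\
      symbols_below (symbol_bound D) (c_right c) &
      (1 \in c_out c') = (1 \in c_out c)].

Lemma lookup_leq_max (f : instruction -> nat) M q a i :
  lookup M q a = Some i -> f i <= \max_(j <- M) f j.
Proof.
rewrite /lookup; elim: M => //= j M IH; rewrite big_cons leq_max.
by case: ifP => [_ [->]|_ /IH->]; rewrite ?leqnn ?orbT.
Qed.

Lemma observes_step D M c c' :
  (forall q a i, lookup (observer D) (shift_state q) a = Some i ->
     lookup M (shift_state q) a = Some i) ->
  observes D c c' ->
  exists2 c2, step M c' = Some c2 & observes D (odflt c (step D c)) c2.
Proof.
move=> HM; case: c c' => q l r o [q' l' r' o'].
case=> [[/= -> qQ] [El Er] [Bl Br] Eo].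
have S0 : 0 < symbol_bound D by [].
have hr : head 0 r' = head 0 r := same_tape_head Er.
have := lookup_observer qQ (symbols_below_head S0 Br).
move=> /HM H; rewrite !stepE /= /scanned /= hr H /=; eexists; first by [].
(* If [D] has halted, stalling changes at most the list for the tape: an implicit blank may become
   explicit. *)
case Hi : (lookup D q (head 0 r)) => [i|] /=; last first.
  split=> //=; last by rewrite mem_rcons inE.
  by split=> //; rewrite -hr; apply: same_tape_head_behead.
have wS : i_write i < symbol_bound D.
  by rewrite ltnS; do 2 apply: leqW; apply: lookup_leq_max Hi.
have nQ : i_next i < state_bound D by rewrite ltnS; apply: lookup_leq_max Hi.
have Bl' := symbols_below_behead Bl; have Br' := symbols_below_behead Br.
have El' := same_tape_behead El; have Er' := same_tape_behead Er.
have hl := same_tape_head El; have hB := symbols_below_head S0 Bl.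
rewrite /execute /=; case: (i_move i) => /=; split=> //=.
all: try by split; do ?[apply: same_tape_cons].
all: try by rewrite ?wS ?hB ?Bl ?Br'.
all: rewrite mem_rcons inE Eo; case: (i_emit i) => [[|[|a]]|] //=.
all: by rewrite ?mem_rcons ?inE.
Qed.

Lemma run_step M inp t : run M inp t.+1 = odflt (run M inp t) (step M (run M inp t)).
Proof. by []. Qed.

Lemma observes_run D M inp t0 :
  (forall q a i, lookup (observer D) (shift_state q) a = Some i ->
     lookup M (shift_state q) a = Some i) ->
  observes D (initial inp) (run M [::] t0) ->
  forall t, observes D (run D inp t) (run M [::] (t0 + t)) /\
            step M (run M [::] (t0 + t)).
Proof.
move=> HM H0 t.
suff H : observes D (run D inp t) (run M [::] (t0 + t)).
  by split=> //; have [c -> _] := observes_step HM H.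
elim: t => [|t IH]; first by rewrite addn0.
have [c E] := observes_step HM IH.
by rewrite addnS !run_step E.
Qed.

Lemma leads_run M q l r : leads M (0, [::], [::]) (q, l, r) ->
  exists t0, run M [::] t0 = Config q l r (nseq t0 0) /\
    forall t, t < t0 -> step M (run M [::] t).
Proof.
move=> [t0 /(_ [::]) /= H]; exists t0.
have sub t : t <= t0 ->
    iter t (obind (step M)) (Some (initial [::])) = Some (run M [::] t).
  elim: t => [|t IH] lt //; rewrite iterS IH ?(ltnW lt) //=.
  (* [None] is fixed by [obind (step M)], so a halt before [t0] would exclude the configuration
     reached at [t0]. *)
  case E: step => //; move: H.
  rewrite -(subnK lt) iterD iterS IH ?(ltnW lt) //= E.
  by rewrite iter_fix.
split=> [|t lt]; first by apply: Some_inj; rewrite -sub.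
by have := sub t.+1 lt; rewrite iterS sub ?(ltnW lt) //= => ->.
Qed.

(** * A machine that observes [D] on its own code, and the ray it writes *)

Definition emits_bit (i : instruction) : bool :=
  if i_emit i is Some a then a < 2 else false.

Lemma all_emits_bit_printer q y : all emits_bit (printer q y).
Proof. by elim: y q => //= c y IH q; rewrite IH. Qed.

Lemma all_observer (p : pred instruction) D :
  (forall i, p (shift_instruction i)) -> (forall q a, p (stall q a)) ->
  all p (observer D).
Proof.
move=> pD ps; rewrite all_cat; apply/andP; split.
  by elim: D => //= i D ->; rewrite pD.
move: (iota 0 (state_bound D)) (iota 0 (symbol_bound D)) => s t.
elim: s => //= q s IH; rewrite all_cat IH andbT all_map.
by apply/allP => a _; apply: ps.
Qed.

(** The needed case of the recursion theorem. There is no circularity: [y] codes only what precedes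
    the printer. *)
Lemma self_applied D pre :
  exists T : machine,
    [/\ all emits_bit T, forall t, step T (run T [::] t) &
        exists t0, forall t,
          (1 \in c_out (run T [::] (t0 + t))) =
          (1 \in c_out (run D (tape_code (pre ++ code_machine T)) t))].
Proof.
pose N := observer D.
(* A nonempty code ends with the 1 closing its last number; [y] is the code without it. *)
have [y Ey] : exists y, tape_code (pre ++ code_machine (generator ++ N)) = rcons y 1.
  have : pre ++ code_machine (generator ++ N) != [::] by case: pre.
  by case/lastP: (pre ++ _) => // s n _; eexists; apply: tape_code_rcons.
pose T := generator ++ N ++ printer 0 y.
have ET : tape_code (pre ++ code_machine T) =
          rcons y 1 ++ tape_code (code_machine (printer 0 y)).
  by rewrite /T [generator ++ _]catA code_machine_cat catA tape_code_cat Ey.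
have biny : binary y.
  have := binary_tape_code (pre ++ code_machine (generator ++ N)).
  by rewrite Ey binary_rcons.
have oddN : all (fun i => odd (i_state i)) N.
  by apply: all_observer => *; rewrite /= oddD odd_double.
have [t0 [Et0 Ht0]] := leads_run (self_leads oddN biny).
have HM q a i : lookup (observer D) (shift_state q) a = Some i ->
    lookup T (shift_state q) a = Some i.
  move=> H; rewrite /T lookup_catr; first exact: lookup_catl.
  have : all (fun i => i_state i < 101) generator by vm_compute.
  by apply: sub_all => j; apply: contraL => /eqP->; rewrite -leqNgt leq_addl.
have H0 : observes D (initial (tape_code (pre ++ code_machine T))) (run T [::] t0).
  rewrite Et0 ET; split=> //=.
  - by split=> //; case=> //= n; rewrite nth_nil.
  - split=> //; rewrite -ET.
    by apply: sub_all (binary_tape_code _) => a; rewrite /= !inE => /orP[] /eqP->.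
  by rewrite mem_nseq andbF.
have Hrun := observes_run HM H0.
exists T; split.
- have aN : all emits_bit N.
    by apply: all_observer => // i; rewrite /emits_bit /=; case: eqP.
  by rewrite /T [generator ++ _]catA all_cat all_emits_bit_printer all_cat aN.
- move=> t; have [/Ht0//|lt] := ltnP t t0.
  by have [_] := Hrun (t - t0); rewrite subnKC.
by exists t0 => t; have [[_ _ _ ->] _] := Hrun t.
Qed.

(** Each step writes exactly one bit, so the output at time [t] has length [t]; bits are letters of
    ['I_d] since [d] is at least 2. *)
Lemma emitted_ray d (T : machine) :
  2 <= d -> all emits_bit T -> (forall t, step T (run T [::] t)) ->
  exists eta : ray d, [/\ outputs_ray T eta, forall n, eta n < 2 &
    forall t, c_out (run T [::] t) = mkseq (fun i => nat_of_ord (eta i)) t].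
Proof.
move=> hd HT Hstep.
have Hout t : exists2 a, a < 2 & c_out (run T [::] t.+1) = rcons (c_out (run T [::] t)) a.
  rewrite run_step; have := Hstep t; rewrite stepE.
  case Hi : lookup => [i|] //= _.
  have := lookup_all HT Hi; rewrite /emits_bit /execute.
  by case: (i_emit i) => // a a2; exists a => //; case: (i_move i).
pose bit n := nth 0 (c_out (run T [::] n.+1)) n.
have size_out t : size (c_out (run T [::] t)) = t.
  by elim: t => // t IH; have [a _ ->] := Hout t; rewrite size_rcons IH.
have bit2 n : bit n < 2.
  by rewrite /bit; have [a a2 ->] := Hout n; rewrite nth_rcons size_out ltnn eqxx.
have out_bit t : c_out (run T [::] t) = mkseq bit t.
  elim: t => // t IH; rewrite mkseqS -IH /bit; have [a _ ->] := Hout t.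
  by rewrite nth_rcons size_out ltnn eqxx.
pose eta n : 'I_d := Ordinal (leq_trans (bit2 n) hd).
exists eta; split=> // n; exists n; rewrite out_bit; exact: prefix_refl.
Qed.

Lemma run_halted M inp t k :
  step M (run M inp t) = None -> run M inp (t + k) = run M inp t.
Proof.
by move=> H; elim: k => [|k IH]; rewrite ?addn0 // addnS run_step IH H.
Qed.

Lemma late_out_halted M inp out k :
  halts_with M inp out ->
  exists2 t, k <= t & c_out (run M inp t) = out.
Proof.
move=> [t [H E]]; exists (t + k); first exact: leq_addl.
by rewrite run_halted.
Qed.

(** * The automaton *)

Section StateAction.
Variables (d : nat) (A : automaton d).
Implicit Types (q : 'I_(nstates A)) (u v : word d).

Definition state_after q v : 'I_(nstates A) := foldl (@Defs.next d A) q v.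

Lemma size_state_act q v : size (state_act q v) = size v.
Proof. by elim: v q => //= c v IH q; rewrite IH. Qed.

Lemma state_act_cat q u v :
  state_act q (u ++ v) = state_act q u ++ state_act (state_after q u) v.
Proof. by elim: u q => //= c u IH q; rewrite IH. Qed.

Lemma section_state_act q v :
  section (state_act q) v = state_act (state_after q v).
Proof.
apply: funext => u.
by rewrite /section state_act_cat drop_size_cat ?size_state_act.
Qed.

Lemma child_state_act q u v : child u v -> child (state_act q u) (state_act q v).
Proof. by move=> [c ->]; rewrite -cats1 state_act_cat /= cats1; eexists. Qed.

(** Applying the map twice gives bijectivity and the converse on children; every section is the
    action of one of finitely many states. *)
Lemma involutive_automaton_automorphism :
  involutive (automaton_act A) -> automaton_automorphism (automaton_act A).
Proof.
move=> invA; split.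
  split=> //; first exact: inv_bij.
  move=> u v; split; first exact: child_state_act.
  by move=> /(@child_state_act (start A)); rewrite -!/(automaton_act _ _) !invA.
apply: (@sub_finite_set _ _ (range (@state_act d A))).
  move=> _ [v _ <-]; exists (state_after (start A) v) => //.
  by rewrite -section_state_act.
apply: finite_image; exact: finite_finset.
Qed.

End StateAction.

(** * The automorphism b as a bounded automaton *)

Section FlipAutomaton.
Variables (d : nat) (hd : 2 <= d).

Let c0 : 'I_d := Ordinal (ltnW hd).
Let c1 : 'I_d := Ordinal hd.

(** [qa] waits for the first nonzero letter, [qs] exchanges 0 and 1 in one letter, and [qe] acts
    trivially. *)
Let qa : 'I_3 := @Ordinal 3 0 isT.
Let qs : 'I_3 := @Ordinal 3 1 isT.
Let qe : 'I_3 := @Ordinal 3 2 isT.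

Definition flip_letter (q : 'I_3) (c : 'I_d) : 'I_d :=
  if q == qs then (if c == c0 then c1 else if c == c1 then c0 else c) else c.

Definition flip_next (q : 'I_3) (c : 'I_d) : 'I_3 :=
  if q == qa then (if c == c0 then qa else if c == c1 then qs else qe) else qe.

Definition flip_automaton : automaton d := Automaton qa flip_letter flip_next.

Let act (q : 'I_3) : word d -> word d := @state_act d flip_automaton q.
Let after (q : 'I_3) : word d -> 'I_3 := @state_after d flip_automaton q.

Lemma ord3_ind (P : 'I_3 -> Prop) : P qa -> P qs -> P qe -> forall q, P q.
Proof.
move=> a s e [[|[|[|//]]] H].
- by congr P: a; apply: val_inj.
- by congr P: s; apply: val_inj.
- by congr P: e; apply: val_inj.
Qed.

Lemma flip_letterK q : involutive (flip_letter q).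
Proof.
rewrite /flip_letter => c; case: eqP => // _.
have [->|n0] := eqVneq c c0; first by [].
have [->|n1] := eqVneq c c1; first by rewrite eqxx.
by rewrite (negPf n0) (negPf n1).
Qed.

(** Only [qs] changes letters, and it passes to [qe] on every letter. So a word and its image run
    through the same states. *)
Lemma flip_next_letter q c : flip_next q (flip_letter q c) = flip_next q c.
Proof. by elim/ord3_ind: q. Qed.

Lemma flip_involutive q : involutive (act q).
Proof.
move=> v; rewrite /act; elim: v q => //= c v IH q.
by rewrite flip_letterK flip_next_letter IH.
Qed.

Lemma after_end v : foldl flip_next qe v = qe.
Proof. by elim: v. Qed.

Lemma act_end v : act qe v = v.
Proof. by rewrite /act; elim: v => //= c v ->. Qed.

Lemma after_zeros n : after qa (nseq n c0) = qa.
Proof. by rewrite /after /state_after; elim: n. Qed.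

Lemma act_zeros n : act qa (nseq n c0) = nseq n c0.
Proof. by rewrite /act; elim: n => //= n ->. Qed.

(** This leaves at most two vertices with a nontrivial section on each level, whence the strict
    bound 3 in [flip_bounded]. *)
Lemma flip_active_words v :
  after qa v != qe -> v = nseq (size v) c0 \/ v = rcons (nseq (size v).-1 c0) c1.
Proof.
rewrite /after /state_after; elim: v => [|c v IH] /=; first by left.
have [->|n0] := eqVneq c c0.
  move=> /IH[E|E]; first by left; rewrite /= -E.
  by right; case: v E {IH} => //= b v E; rewrite E.
rewrite {2}/flip_next /= (negPf n0); have [->|_] := eqVneq c c1.
  by case: v {IH} => [|b v]; [right|rewrite /= after_end].
by rewrite after_end.
Qed.

Lemma flip_bounded : bounded_automaton_automorphism (automaton_act flip_automaton).
Proof.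
split; first exact/involutive_automaton_automorphism/flip_involutive.
exists 3 => -[//|k] _; rewrite ltnS.
apply: (@leq_trans
    #|[set nseq_tuple k.+1 c0; [tuple of rcons (nseq_tuple k c0) c1]]%SET|).
  apply/subset_leq_card/fintype.subsetP => v; rewrite !inE => act_v.
  have : after qa v != qe.
    apply/eqP => Ev; apply: act_v; apply: funext => u.
    by rewrite section_state_act -/(after _ _) Ev -/(act _) act_end.
  move=> /flip_active_words; rewrite (size_tuple v) => -[]/= Ev.
    by apply/orP; left; apply/eqP/val_inj.
  by apply/orP; right; apply/eqP/val_inj.
by rewrite cards2; case: (_ != _).
Qed.

Lemma flip_states_are_sections : states_are_sections flip_automaton.
Proof.
split.
  (* This word separates the states: [qa], [qs] and [qe] send it to 11, 00 and 10. *)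
  have E q q' : act q = act q' -> act q [:: c1; c0] = act q' [:: c1; c0] by move=> ->.
  by elim/ord3_ind => //; elim/ord3_ind => // /E.
have sec v : section (automaton_act flip_automaton) v = act (after qa v).
  exact: section_state_act.
apply/seteqP; split=> [_ [q _ <-]|_ [v _ <-]]; last by exists (after qa v).
elim/ord3_ind: q.
- by exists [::].
- by exists [:: c1] => //; rewrite sec.
- by exists [:: c1; c1] => //; rewrite sec.
Qed.

Lemma flip_fixes_ray (eta : ray d) :
  (forall n, eta n = 0 :> nat) -> ray_act (automaton_act flip_automaton) eta = eta.
Proof.
move=> eta0; have E m : mkseq eta m = nseq m c0.
  apply: (@eq_from_nth _ c0); rewrite size_mkseq ?size_nseq // => i lt.
  by rewrite nth_mkseq // nth_nseq lt; apply: val_inj; apply: eta0.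
apply: funext => n; rewrite /ray_act E -[automaton_act _]/(act qa) act_zeros.
by rewrite nth_nseq ltnSn; apply: val_inj; rewrite /= eta0.
Qed.

(** After the first 1, at position [j], the letter at [j.+1] is exchanged. The bound on [eta]
    matters: a letter above 1 would stay fixed there. *)
Lemma flip_moves_ray (eta : ray d) :
  (forall n, eta n < 2) -> ray_act (automaton_act flip_automaton) eta = eta ->
  forall n, eta n = 0 :> nat.
Proof.
move=> eta2 fixed n; apply/eqP; apply: contraT => etan.
have [j etaj minj] := ex_minnP (ex_intro (fun n => eta n != 0 :> nat) n etan).
have bit m : eta m = c0 \/ eta m = c1.
  have := eta2 m; case E : (nat_of_ord (eta m)) => [|[|//]] _.
    by left; apply: val_inj.
  by right; apply: val_inj.
have Ej : eta j = c1 by case: (bit j) etaj => [->|].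
(* [ray_act] at position [j.+1] reads the prefix of length [j.+2]. *)
have E : mkseq eta j.+2 = nseq j c0 ++ [:: c1; eta j.+1].
  rewrite !mkseqS -!cats1 -catA Ej; congr (_ ++ _).
  apply: (@eq_from_nth _ c0); rewrite size_mkseq ?size_nseq // => i lt.
  rewrite nth_mkseq // nth_nseq lt; apply: val_inj => /=; apply/eqP.
  by apply: contraTT lt => /minj; rewrite leqNgt.
have := congr1 (fun f => f j.+1) fixed.
rewrite /ray_act E /automaton_act state_act_cat -[state_act _ _]/(act qa _) act_zeros.
rewrite -[state_after _ _]/(after qa _) after_zeros.
rewrite nth_cat size_nseq ltnNge leqnSn /= subSn // subnn /=.
by case: (bit j.+1) => ->.
Qed.

End FlipAutomaton.

(** * The contradiction with a decision machine *)

Theorem proposition2p11 (d : nat) (hd : 2 <= d) :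
  ~ exists D : machine,
      forall (k : nat) (A : k.-tuple (automaton d)) (w : seq 'I_k)
             (T : machine) (eta : ray d),
        let gen := fun i : 'I_k => automaton_act (tnth A i) in
        let X := range gen in
        (forall i, bounded_automaton_automorphism (gen i)) ->
        (forall i, states_are_sections (tnth A i)) ->
        injective gen ->
        symmetric_set X ->
        outputs_ray T eta ->
        exists b : bool,
          (b <-> WP X (Stab (generated X) eta) (map gen w)) /\
          halts_with D (code_input A w T) [:: nat_of_bool b].
Proof.
move=> [D HD].
pose A := [tuple flip_automaton hd]; pose w : seq 'I_1 := [:: ord0].
have EA i : tnth A i = flip_automaton hd by rewrite (ord1 i) tnth0.
have [pre Epre] : exists pre, forall T,
    code_input A w T = tape_code (pre ++ code_machine T).
  (* The leading 1 is the number of automata; the final 1 and 0 are the length of [w] and its only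
     letter. *)
  exists (1 :: flatten (map (@code_automaton d) A) ++ [:: 1; 0]) => T.
  by rewrite /code_input cat_cons -catA.
have [T [emitsT runsT [t0 ET]]] := self_applied D pre.
have [eta [Teta eta2 out_eta]] := emitted_ray hd emitsT runsT.
set g := automaton_act (flip_automaton hd).
pose gen (i : 'I_1) := automaton_act (tnth A i).
have geng i : gen i = g by rewrite /gen EA.
have gK : involutive g by exact: flip_involutive.
have [] := HD 1 A w T eta _ _ _ _ Teta.
- by move=> i; rewrite EA; apply: flip_bounded.
- by move=> i; rewrite EA; apply: flip_states_are_sections.
- by move=> i j _; rewrite (ord1 i) (ord1 j).
- by move=> _ [i _ <-]; exists g; [exists i|]; rewrite //= EA.
move=> b [Hb0]; rewrite Epre.
have WPE : WP (range gen) (Stab (generated (range gen)) eta) (map gen w) <->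
          ray_act g eta = eta.
  rewrite /WP /Stab /= geng.
  split=> [[_ []]//|fixed]; split.
    by apply/List.Forall_forall => _ [<-|[]]; exists ord0.
  by split=> //; apply: generated_gen; exists ord0.
have {Hb0 WPE} := iff_trans Hb0 WPE; case: b => Hb Hhalt.
(* On the answer yes, the ray is constantly 0, although [T] has copied the 1 output by [D]. *)
- have /(flip_moves_ray eta2) eta0 := Hb.1 isT.
  have [t _ Et] := late_out_halted 0 Hhalt.
  have := ET t; rewrite Et inE eqxx out_eta => /mapP[i _].
  by rewrite eta0.
(* On the answer no, the output of [D] is read at a time [t] at least [n.+1]: a 1 at position [n] of
   [eta] would already be written by [T], while [D] shows [[:: 0]]. *)
- suff : false by [].
  apply/Hb/flip_fixes_ray => n; apply/eqP; apply: contraT => etan.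
  have [t le Et] := late_out_halted n.+1 Hhalt.
  have /negP[] : 1 \notin c_out (run T [::] (t0 + t)) by rewrite ET Et.
  rewrite out_eta; apply/mapP; exists n.
    by rewrite mem_iota add0n; apply: leq_trans le (leq_addl _ _).
  by have := eta2 n; case: (nat_of_ord (eta n)) etan => [|[]].
Qed.
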